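(* Let $\alpha\in(0,1)$, let $\psi_\alpha:(0,\infty)\to(0,\infty)$ be a bijective map, let $\phi_\alpha(t)=\int_0^t\frac{1}{\psi_\alpha(s)}\,ds$, let $\mathbf{f}:\mathbb{R}^n\to\mathbb{R}^n$ be a vector field, and let $\mathbf{x}_0\in\mathbb{R}^n$. The conformable dynamical system $$D_\psi^\alpha\mathbf{x}(t)=\mathbf{f}(\mathbf{x}(t)),\qquad \mathbf{x}(0)=\mathbf{x}_0,$$ with $\mathbf{x}(t)\in\mathbb{R}^n$, is equivalent to the classical dynamical system $$\frac{d\mathbf{y}}{d\tau}=\mathbf{f}(\mathbf{y}(\tau)),\qquad \mathbf{y}(0)=\mathbf{x}_0,$$ by the change of variable $\tau=\phi_\alpha(t)$ and $\mathbf{y}(\tau)=\mathbf{x}(t)$. That is, $\mathbf{x}$ is a solution of the conformable system if and only if the function $\mathbf{y}$ defined by $\mathbf{y}(\phi_\alpha(t))=\mathbf{x}(t)$ is a solution of the classical system.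
   Context: The map $\psi_\alpha$ is such that the integral $\phi_\alpha(t)=\int_0^t\frac{1}{\psi_\alpha(s)}\,ds$ is well defined (finite) for $t\ge 0$. For a function $f:[0,\infty)\to\mathbb{R}$ and $t>0$, the conformable derivative of order $\alpha$ with respect to the weight function $\psi_\alpha$ is $$D^{\alpha}_{\psi}(f)(t)=\lim_{\varepsilon\to0}\frac{f(t+\varepsilon\,\psi_\alpha(t))-f(t)}{\varepsilon}$$ when this limit exists. If it exists for all $t$ in some interval $(0,b)$, $b>0$, and $\lim_{t\to0^+}D^{\alpha}_{\psi}(f)(t)$ exists, then $D^{\alpha}_{\psi}(f)(0)$ is defined to be that limit. For $\mathbb{R}^n$-valued functions, $D_\psi^\alpha$ is applied componentwise.
   Formalization: ψ_α is assumed continuous on (0,∞) (the claim fails for a bijection with two values swapped), solutions are required to be continuous at time 0, and the version with the equations also at time 0 assumes f continuous at x_0. *)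

(* Defs.v *)
(* MathComp-Analysis; the reals are an arbitrary realType. *)
From HB Require Import structures.
From mathcomp Require Import all_boot all_order all_algebra.
From mathcomp Require Import all_classical all_reals all_analysis.

Set Implicit Arguments.
Unset Strict Implicit.
Unset Printing Implicit Defensive.

Import Order.TTheory GRing.Theory Num.Theory.
Import numFieldNormedType.Exports.

Local Open Scope classical_set_scope.
Local Open Scope ring_scope.

(* Functions on [0, +oo[ or ]0, +oo[ are represented by total functions on R;
   none of the definitions below depends on values outside the stated domain
   (the weight w is only evaluated at positive times). *)

Definition conformable_deriv (R : realType) (w g : R -> R) (t l : R) : Prop :=
  (g (t + eps * w t) - g t) / eps @[eps --> 0^'] --> l.

Definition conformable_deriv0 (R : realType) (w g : R -> R) (l : R) : Prop :=
  exists2 b : R, 0 < b &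
  exists2 dg : R -> R,
    (forall t, 0 < t < b -> conformable_deriv w g t (dg t)) &
    dg t @[t --> 0^'+] --> l.

Definition time_change (R : realType) (w : R -> R) (t : R) : R :=
  (\int[lebesgue_measure]_(s in `]0%R, t]) (w s)^-1)%R.

Definition time_interval (R : realType) (b : \bar R) : set R :=
  [set t | 0 <= t /\ (t%:E < b)%E].

(* A solution is continuous at the initial time: the equation at positive times
   (and even the value of the conformable derivative at 0, which is a limit of
   derivatives) does not see x 0, so the initial condition would otherwise be
   void. *)
Definition conformable_solution (R : realType) (n : nat) (w : R -> R)
    (f : 'rV[R]_n -> 'rV[R]_n) (x0 : 'rV[R]_n) (J : set R)
    (x : R -> 'rV[R]_n) : Prop :=
  [/\ x 0 = x0,
      x t @[t --> 0^'+] --> x 0 &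
      forall t, J t -> 0 < t -> forall i : 'I_n,
        conformable_deriv w (fun s => x s ord0 i) t (f (x t) ord0 i)].

Definition classical_solution (R : realType) (n : nat)
    (f : 'rV[R]_n -> 'rV[R]_n) (x0 : 'rV[R]_n) (J : set R)
    (y : R -> 'rV[R]_n) : Prop :=
  [/\ y 0 = x0,
      y tau @[tau --> 0^'+] --> y 0 &
      forall tau, J tau -> 0 < tau -> is_derive tau 1 y (f (y tau))].

(* The equations at the initial time; the classical one uses the right
   derivative. *)
Definition conformable_equation0 (R : realType) (n : nat) (w : R -> R)
    (f : 'rV[R]_n -> 'rV[R]_n) (x : R -> 'rV[R]_n) : Prop :=
  forall i : 'I_n,
    conformable_deriv0 w (fun s => x s ord0 i) (f (x 0) ord0 i).

Definition classical_equation0 (R : realType) (n : nat)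
    (f : 'rV[R]_n -> 'rV[R]_n) (y : R -> 'rV[R]_n) : Prop :=
  h^-1 *: (y h - y 0) @[h --> 0^'+] --> f (y 0).

(* Main.v *)
(* At a time t > 0 the conformable derivative is w(t) times the ordinary one, and
   phi has derivative 1 / w(t) there, so the equations correspond by the chain
   rule along phi and its inverse. The equations at the initial time hold
   automatically for solutions when f is continuous at x0: the derivatives at
   positive times converge to f x0, and by l'Hopital's rule so does the right
   difference quotient at 0. *)
Require Import Defs.
From HB Require Import structures.
From mathcomp Require Import all_boot all_order all_algebra.
From mathcomp Require Import all_classical all_reals all_analysis.
From mathcomp Require Import measurable_realfun.

Set Implicit Arguments.
Unset Strict Implicit.
Unset Printing Implicit Defensive.

Import Order.TTheory GRing.Theory Num.Theory.
Import numFieldNormedType.Exports.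

Local Open Scope classical_set_scope.
Local Open Scope ring_scope.

(** * Conformable and ordinary derivatives at a positive weight *)

Lemma dnbhs0M (R : realType) (c : R) : c != 0 ->
  c * h @[h --> (0 : R)^'] --> (0 : R)^'.
Proof.
move=> c0 P P0.
have c0P : nbhs (c * 0) (fun y : R => y != 0 -> P y) by rewrite mulr0.
have cP : \forall h \near (0 : R), c * h != 0 -> P (c * h).
  exact: (@mulrl_continuous R c 0 _ c0P).
rewrite /nbhs/=; near=> h.
have h0 : h != 0 by near: h; exact: nbhs_dnbhs_neq.
by apply: (near (nbhs_dnbhs cP) h) => //; rewrite mulf_neq0.
Unshelve. all: by end_near. Qed.

(** The substitution [h = eps * w t] turns one difference quotient into the other up to the constant
    factor [w t]; scaling by a nonzero constant preserves the punctured neighbourhoods of 0. Only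
    the value of [w] at [t] enters. *)
Lemma conformable_derivP (R : realType) (w g : R -> R) (t l : R) : w t != 0 ->
  conformable_deriv w g t l <-> is_derive t 1 g ((w t)^-1 * l).
Proof.
move=> wt0; split=> [gl|[/cvg_ex[l' gl']]].
- suff dgl : h^-1 *: (g (h *: 1 + t) - g t) @[h --> 0^'] --> (w t)^-1 * l.
    by apply: DeriveDef; [apply/cvg_ex; exists ((w t)^-1 * l)|exact: cvg_lim].
  have wtV0 : (w t)^-1 != 0 by rewrite invr_neq0.
  apply: cvg_trans (cvgM (cvg_cst (w t)^-1) (cvg_comp _ _ (dnbhs0M wtV0) gl)).
  apply: near_eq_cvg; near=> h => /=.
  rewrite mulrAC mulVf// mul1r invfM invrK [h *: 1]mulr1 (addrC h).
  by rewrite mulrC -mulrA [w t / h]mulrC mulfK// mulrC.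
- rewrite /derive (cvg_lim _ gl')// => l'E.
  have -> : l = w t * l' by rewrite l'E mulVKf.
  apply: cvg_trans (cvgM (cvg_cst (w t)) (cvg_comp _ _ (dnbhs0M wt0) gl')).
  apply: near_eq_cvg; near=> h => /=.
  rewrite [_ *: 1]mulr1 (addrC _ t) (mulrC h).
  by rewrite [_ *: _]mulrC invfM mulrCA mulVKf.
Unshelve. all: by end_near. Qed.

(** * Limits and derivatives of row vectors, coordinate by coordinate *)

Lemma cvg_rowP (R : realType) (T : Type) (F : set_system T) {FF : Filter F}
    (n : nat) (u : T -> 'rV[R]_n) (v : 'rV[R]_n) :
  u @ F --> v <-> forall i, u t ord0 i @[t --> F] --> v ord0 i.
Proof.
split=> [uv i|uv].
  apply: (cvg_comp u (fun M : 'rV[R]_n => M ord0 i) uv).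
  exact: coord_continuous.
apply/cvgrPdist_le => /= e e0.
near=> t; rewrite /Num.Def.normr/= mx_normrE (bigmax_le _ (ltW e0))//=.
move=> [j i] _; rewrite !mxE/= (ord1 j).
(* There are finitely many coordinates, so their estimates hold simultaneously along [F]. *)
move: i; near: t; apply: filter_forall => i.
exact: ((cvgrPdist_le _ _).1 (uv i)).
Unshelve. all: by end_near. Qed.

Lemma is_derive_rowP (R : realType) (n : nat) (y : R -> 'rV[R]_n) (t : R)
    (v : 'rV[R]_n) :
  is_derive t 1 y v <->
  forall i, is_derive t 1 (fun s => y s ord0 i) (v ord0 i).
Proof.
split=> [[dy yv] i|dy].
  have dyi := (derivable_mxP y t 1).1 dy ord0 i.
  by apply: DeriveDef => //; rewrite -yv derive_mx// mxE.
have dyM : derivable y t 1.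
  by apply/derivable_mxP => j i; rewrite (ord1 j); exact: ex_derive.
apply: DeriveDef => //; rewrite derive_mx//; apply/rowP => i.
by rewrite mxE derive_val.
Qed.

Lemma is_derive_row_comp (R : realType) (n : nat) (y : R -> 'rV[R]_n)
    (g : R -> R) (t a : R) (v : 'rV[R]_n) :
  is_derive (g t) 1 y v -> is_derive t 1 g a ->
  is_derive t 1 (y \o g) (a *: v).
Proof.
move=> /is_derive_rowP dy dg; apply/is_derive_rowP => i; rewrite mxE mulrC.
exact: (is_derive1_comp (f := fun s => y s ord0 i)).
Qed.

(** L'Hopital's rule is scalar, hence applied to each coordinate of [y t - y 0] over [t]; the
    quotient of derivatives is [f (y t)] over 1. *)
Lemma right_derivative_limit (R : realType) (n : nat)
    (f : 'rV[R]_n -> 'rV[R]_n) (y : R -> 'rV[R]_n) (d : R) :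
  0 < d -> (forall t : R, 0 < t < d -> is_derive t 1 y (f (y t))) ->
  y t @[t --> 0^'+] --> y 0 -> {for y 0, continuous f} ->
  h^-1 *: (y h - y 0) @[h --> 0^'+] --> f (y 0).
Proof.
move=> d0 dy y0 cf; apply/cvg_rowP => i.
have fy : f (y t) ord0 i @[t --> 0^'+] --> f (y 0) ord0 i.
  exact: ((cvg_rowP _ _).1 (cvg_comp y f y0 cf) i).
pose g t := y t ord0 i - y 0 ord0 i.
suff : g t / t @[t --> 0^'+] --> f (y 0) ord0 i.
  by apply: cvg_trans; apply: near_eq_cvg; near=> t; rewrite !mxE mulrC.
apply: (@lhopital_at_right _ g (fun t => f (y t) ord0 i) id (fun=> 1)
  0 d _ d0) => //=.
- move=> t; rewrite in_itv/= => td.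
  rewrite -[f _ _ _]subr0; apply: is_deriveB.
  exact: ((is_derive_rowP _ _ _).1 (dy t td)).
- rewrite -[X in _ --> X](subrr (y 0 ord0 i)); apply: cvgB; last exact: cvg_cst.
  exact: ((cvg_rowP _ _).1 y0 i).
- by apply: cvg_at_right_filter; exact: cvg_id.
- by under eq_fun do rewrite divr1.
Unshelve. all: by end_near. Qed.

Lemma cvg_to_at_right (R : realType) (T : Type) (F : set_system T)
    {FF : Filter F} (u : T -> R) (a : R) :
  (\forall t \near F, a < u t) -> u @ F --> a -> u @ F --> a^'+.
Proof.
move=> a_lt ua P aP; have uaP := ua _ aP.
by apply: filterS2 a_lt uaP => t ut /(_ ut).
Qed.

(** * The time change [phi]: continuity, derivative, monotonicity *)

Section TimeChange.
Context (R : realType) (w : R -> R).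
Hypothesis w_gt0 : forall t : R, 0 < t -> 0 < w t.
Hypothesis w_cont : forall t : R, 0 < t -> {for t, continuous w}.
Hypothesis w_int : forall t : R, 0 <= t ->
  (@lebesgue_measure R).-integrable `]0, t] (EFin \o (fun s => (w s)^-1)).
Local Notation phi := (time_change w).

Lemma time_change0 : phi 0 = 0.
Proof. by rewrite /time_change set_itvoc0 Rintegral_set0. Qed.

Lemma time_change_cvg0 : phi t @[t --> 0^'+] --> phi 0.
Proof.
rewrite time_change0.
(* The limit of the parameterized integral is taken on a closed interval; adding the null point 0
   changes neither measurability nor the integral, whatever [w 0] is. *)
have int01 : (@lebesgue_measure R).-integrable `[0, 1]
    (EFin \o (fun s => (w s)^-1)).
  have /integrableP[mw int_lty] := w_int ler01.
  have mw' := (emeasurable_fun_itv_obnd_cbndP _ _ _).1 mw.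
  apply/integrableP; split=> //.
  rewrite -integral_itv_obnd_cbnd//.
  exact/measurableT_comp.
have := cvg_at_right_filter (parameterized_integral_cvg_left ltr01 int01).
apply: cvg_trans; apply: near_eq_cvg; near=> t.
rewrite /time_change /parameterized_integral Rintegral_itv_obnd_cbnd//.
exact: w_int.
Unshelve. all: by end_near. Qed.

Lemma is_derive_time_change (t : R) : 0 < t -> is_derive t 1 phi (w t)^-1.
Proof.
move=> t0.
(* Integrating past [t] makes [t] an interior point, so the derivative obtained is two-sided. *)
have tt1 : t < t + 1 by rewrite ltrDl.
have [] := @continuous_FTC1 R (fun s => (w s)^-1) (BRight 0) t _ tt1.
- by apply: w_int; rewrite addr_ge0// ltW.
- by [].
- by apply: cvgV; [rewrite gt_eqF// w_gt0|exact: w_cont].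
by move=> dphi phiE; apply: DeriveDef dphi _; rewrite -derive1E; exact: phiE.
Qed.

Lemma time_change_within (t : R) : 0 <= t -> {within `[0, t], continuous phi}.
Proof.
rewrite le_eqVlt => /predU1P[<-|t0].
  by rewrite set_itv1; exact: continuous_subspace1.
have cphi s : 0 < s -> {for s, continuous phi}.
  move=> s0; apply/differentiable_continuous/derivable1_diffP.
  by have [] := is_derive_time_change s0.
apply/continuous_within_itvP => //; split.
- by move=> s; rewrite in_itv/= => /andP[s0 _]; exact: cphi.
- exact: time_change_cvg0.
- by apply: cvg_at_left_filter; exact: cphi.
Qed.

(** By the mean value theorem, since the derivative [(w c)^-1] is positive at interior points; at
    [s = 0] continuity of [phi] suffices. *)
Lemma time_change_lt (s t : R) : 0 <= s -> s < t -> phi s < phi t.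
Proof.
move=> s0 st; have t0 := le_lt_trans s0 st.
have [||c /[!in_itv]/= /andP[sc ct] phiE] :=
  @MVT _ phi (fun t => (w t)^-1) _ _ st.
- move=> x /[!in_itv]/= /andP[sx _].
  exact: is_derive_time_change (le_lt_trans s0 sx).
- apply: continuous_subspaceW (time_change_within (ltW t0)).
  by apply: subset_itv; rewrite bnd_simp.
rewrite -subr_gt0 phiE mulr_gt0 ?subr_gt0// invr_gt0 w_gt0//.
exact: le_lt_trans sc.
Qed.

Lemma time_change_inj (s t : R) : 0 <= s -> 0 <= t -> phi s = phi t -> s = t.
Proof.
move=> s0 t0; case: (ltgtP s t) => // [st|ts] phiE.
- by have := time_change_lt s0 st; rewrite phiE ltxx.
- by have := time_change_lt t0 ts; rewrite phiE ltxx.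
Qed.

Lemma time_change_gt0 (t : R) : 0 < t -> 0 < phi t.
Proof. by move=> t0; rewrite -time_change0 time_change_lt. Qed.

Lemma time_change_onto (t tau : R) : 0 <= t -> 0 <= tau <= phi t ->
  exists2 s, 0 <= s <= t & phi s = tau.
Proof.
move=> t0 tauphi.
have phi_ge0 : phi 0 <= phi t.
  by rewrite time_change0; case/andP: tauphi; exact: le_trans.
have [|s s0t <-] := IVT t0 (time_change_within t0) (v := tau).
  by rewrite min_l// max_r// time_change0.
by exists s => //; rewrite in_itv/= in s0t.
Qed.

(** * One-sided limits at 0 and the inverse of [phi] *)

Lemma time_change_at_right : phi t @[t --> 0^'+] --> (0 : R)^'+.
Proof.
apply: cvg_to_at_right; last first.
  by rewrite -[X in _ --> X]time_change0; exact: time_change_cvg0.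
by near=> t; apply: time_change_gt0.
Unshelve. all: by end_near. Qed.

(** The inverse of [phi] on its range, which may be bounded; elsewhere the default value is 0. *)
Definition time_unchange (tau : R) : R :=
  xget 0 [set t | 0 <= t /\ phi t = tau].

Lemma time_changeK (t : R) : 0 <= t -> time_unchange (phi t) = t.
Proof.
by move=> t0; apply: xget_unique => // s [s0]; exact: time_change_inj.
Qed.

Lemma near_time_changeK (t : R) : 0 < t -> {near t, cancel phi time_unchange}.
Proof.
move=> t0; near=> s; apply: time_changeK; apply: ltW; near: s.
exact: lt_nbhsr.
Unshelve. all: by end_near. Qed.

Lemma near_time_change_continuous (t : R) : 0 < t -> {near t, continuous phi}.
Proof.
move=> t0; near=> s; apply/differentiable_continuous/derivable1_diffP.
have s0 : 0 < s by near: s; exact: lt_nbhsr.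
by have [] := is_derive_time_change s0.
Unshelve. all: by end_near. Qed.

(** A continuous map that is injective near [t] covers a neighbourhood of [phi t], so the left
    inverse is also a right inverse there. *)
Lemma near_time_unchangeK (t : R) : 0 < t -> {near phi t, cancel time_unchange phi}.
Proof.
move=> t0; apply: near_continuous_can_sym.
- exact: near_time_change_continuous.
- exact: near_time_changeK.
Qed.

Lemma is_derive_time_unchange (t : R) : 0 < t ->
  is_derive (phi t) 1 time_unchange (w t).
Proof.
move=> t0; rewrite -[w t]invrK; apply: is_derive_inverse.
- exact: near_time_changeK.
- exact: near_time_change_continuous.
- exact: is_derive_time_change.
- by rewrite invr_neq0// gt_eqF// w_gt0.
Qed.

(** For [0 < tau <= phi e] the intermediate value theorem puts the preimage of [tau] in [[0, e]],
    and it is not 0 because [phi 0 = 0]. *)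
Lemma near0_time_unchange (e : R) : 0 < e -> \forall tau \near 0^'+,
  0 < time_unchange tau <= e /\ phi (time_unchange tau) = tau.
Proof.
move=> e0; near=> tau.
have tau0 : 0 < tau by [].
have [|s /andP[s0 se] phis] := @time_change_onto e tau (ltW e0).
  rewrite ltW//=; near: tau; apply: nbhs_right_le.
  exact: time_change_gt0.
rewrite -phis time_changeK// se andbT lt_neqAle s0 andbT; split=> //.
by apply: contra_ltN tau0 => /eqP s0E; rewrite -phis -s0E time_change0.
Unshelve. all: by end_near. Qed.

Lemma time_unchange_at_right :
  time_unchange tau @[tau --> 0^'+] --> (0 : R)^'+.
Proof.
apply: cvg_to_at_right.
  by apply: filterS (near0_time_unchange ltr01) => tau [/andP[]].
apply/cvgrPdist_le => e e0.
apply: filterS (near0_time_unchange e0) => tau [/andP[tau0 taue] _].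
by rewrite sub0r normrN gtr0_norm.
Qed.

(** * Time intervals near their points *)

Lemma near_time_interval (b : \bar R) (t : R) : 0 < t -> time_interval b t ->
  \forall s \near t, time_interval b s.
Proof.
move=> t0 [_ tb]; have sb : \forall s \near t, (s%:E < b)%E.
  case: b tb => [r tr| _|//]; last by near=> s; rewrite ltry.
  by rewrite lte_fin in tr; apply: filterS (lt_nbhsl tr) => s; rewrite lte_fin.
by apply: filterS2 (lt_nbhsr t0) sb => s /ltW.
Unshelve. all: by end_near. Qed.

Lemma near_time_interval0 (b : \bar R) : (0 < b)%E ->
  \forall s \near 0^'+, time_interval b s.
Proof.
move=> b0; have sb : \forall s \near (0 : R)^'+, (s%:E < b)%E.
  case: b b0 => [r r0| _|//]; last by near=> s; rewrite ltry.
  by rewrite lte_fin in r0; apply: filterS (nbhs_right_lt r0) => s; rewrite lte_fin.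
by apply: filterS2 (nbhs_right_gt 0) sb => s /ltW.
Unshelve. all: by end_near. Qed.

(** * Correspondence of solutions and of the equations at time 0 *)

Variables (n : nat) (f : 'rV[R]_n -> 'rV[R]_n) (x0 : 'rV[R]_n).
Variables (b : \bar R) (x y : R -> 'rV[R]_n).
Hypothesis b_gt0 : (0 < b)%E.
Hypothesis yE : forall t, time_interval b t -> y (phi t) = x t.
Let J := time_interval b.

Let y0E : y 0 = x 0.
Proof. by rewrite -{1}time_change0 yE//; split. Qed.

Let image_gt0 tau : (phi @` J) tau -> 0 < tau ->
  exists t, [/\ 0 < t, J t & phi t = tau].
Proof.
move=> [t Jt <-] phit0; exists t; split=> //.
have [+ _] := Jt; rewrite le_eqVlt => /predU1P[t0|//].
by rewrite -t0 time_change0 ltxx in phit0.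
Qed.

(** By continuity the inverse of [phi] takes values in [J] near [phi t], so [yE] applies to them and
    expresses [y] through [x] on a full neighbourhood, as a derivative requires. *)
Let yE_near t : 0 < t -> J t ->
  \forall tau \near phi t, x (time_unchange tau) = y tau.
Proof.
move=> t0 Jt.
have cphi : {for phi t, continuous time_unchange}.
  apply/differentiable_continuous/derivable1_diffP.
  by have [] := is_derive_time_unchange t0.
have Jnear : \forall tau \near phi t, J (time_unchange tau).
  apply: cphi; rewrite time_changeK; last exact: ltW.
  exact: near_time_interval.
by apply: filterS2 Jnear (near_time_unchangeK t0) => tau /yE <- ->.
Qed.

Lemma conformable_classical_solution :
  conformable_solution w f x0 J x <-> classical_solution f x0 (phi @` J) y.
Proof.
split=> -[xy0 cxy0 dxy]; split.
- by rewrite y0E.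
- rewrite y0E; apply: cvg_trans (cvg_comp _ _ time_unchange_at_right cxy0).
  have Jnear : \forall tau \near 0^'+, J (time_unchange tau).
    exact: time_unchange_at_right (near_time_interval0 b_gt0).
  apply: near_eq_cvg; apply: filterS2 Jnear (near0_time_unchange ltr01).
  by move=> tau /yE /= <- [_ ->].
- move=> tau tauJ tau0; have [t [t0 Jt <-]] := image_gt0 tauJ tau0; rewrite yE//.
  apply: (near_eq_is_derive (f := x \o time_unchange)); first exact: yE_near.
  have wt0 : w t != 0 by rewrite gt_eqF// w_gt0.
  (* The outer factor [w t] is the derivative of the inverse time change; the inner vector
     [(w t)^-1 *: f (x t)] is the ordinary derivative of [x]. *)
  rewrite -(scalerKV wt0 (f (x t))).
  apply: is_derive_row_comp; last exact: is_derive_time_unchange.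
  rewrite time_changeK; last exact: ltW.
  apply/is_derive_rowP => i; rewrite mxE; apply/conformable_derivP => //.
  exact: dxy.
- by rewrite -y0E.
- rewrite -y0E; apply: cvg_trans (cvg_comp _ _ time_change_at_right cxy0).
  apply: near_eq_cvg; apply: filterS (near_time_interval0 b_gt0) => t Jt.
  by rewrite -(yE Jt).
- move=> t Jt t0 i; apply/conformable_derivP; first by rewrite gt_eqF// w_gt0.
  have -> : (w t)^-1 * f (x t) ord0 i = ((w t)^-1 *: f (x t)) ord0 i.
    by rewrite mxE.
  apply: (is_derive_rowP x t ((w t)^-1 *: f (x t))).1.
  (* Conversely [x] is [y \o phi] near [t], and [phi] contributes the factor [(w t)^-1]. *)
  apply: (near_eq_is_derive (f := y \o phi)).
    by apply: filterS (near_time_interval t0 Jt) => s /yE.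
  apply: is_derive_row_comp; last exact: is_derive_time_change.
  by rewrite -yE//; apply: dxy; [exists t|exact: time_change_gt0].
Qed.

Lemma conformable_solution_equation0 : {for x0, continuous f} ->
  conformable_solution w f x0 J x -> conformable_equation0 w f x.
Proof.
move=> cf [xx0 cx dx] i.
have := near_time_interval0 b_gt0.
rewrite near_withinE => -[e e0 eJ].
(* The system itself gives the conformable derivative on []0, e[]; its limit at 0 comes from
   continuity of [f] at [x0]. *)
exists e => //; exists (fun t => f (x t) ord0 i).
  move=> t /andP[t0 te]; apply: dx => //; apply: eJ => //.
  by rewrite /ball_/= sub0r normrN gtr0_norm.
by apply: (cvg_rowP _ _).1; rewrite -xx0 in cf; exact: cvg_comp cx cf.
Qed.

Lemma classical_solution_equation0 : {for x0, continuous f} ->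
  classical_solution f x0 (phi @` J) y -> classical_equation0 f y.
Proof.
move=> cf [yy0 cy dy].
have := near_time_interval0 b_gt0.
rewrite near_withinE => -[e e0 eJ].
(* Halving gives a closed interval [[0, e / 2]] inside [J]; times below [phi (e / 2)] have their
   preimages there. *)
have e20 : 0 < e / 2 by rewrite divr_gt0.
apply: right_derivative_limit (time_change_gt0 e20) _ cy _; last by rewrite yy0.
move=> tau /andP[tau0 taue]; apply: dy; last exact: tau0.
have [|s /andP[s0 se] <-] := time_change_onto (ltW e20) (tau := tau).
  by rewrite !ltW.
exists s => //; move: s0; rewrite le_eqVlt => /predU1P[<-|s0].
  by split.
apply: eJ => //=; rewrite sub0r normrN gtr0_norm//.
by rewrite (le_lt_trans se)// ltr_pdivrMr// ltr_pMr// ltr1n.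
Qed.

End TimeChange.

(** Injectivity of [phi] ensures that [y (phi t) = x t] consistently defines [y] on the image of
    [J]. *)
Theorem proposition2 (R : realType) (n : nat) (alpha : R) (psi : R -> R -> R)
    (f : 'rV[R]_n -> 'rV[R]_n) (x0 : 'rV[R]_n)
    (alpha01 : 0 < alpha < 1)
    (psi_bij : set_bij `]0, +oo[ `]0, +oo[ (psi alpha))
    (psi_cont : {in `]0, +oo[, continuous (psi alpha)})
    (phi_fin : forall t : R, 0 <= t ->
       (@lebesgue_measure R).-integrable `]0, t]
         (EFin \o (fun s => (psi alpha s)^-1))) :
  let phi := time_change (psi alpha) in
  (forall s t : R, 0 <= s -> 0 <= t -> phi s = phi t -> s = t) /\
  forall (b : \bar R) (x y : R -> 'rV[R]_n), (0 < b)%E ->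
    (forall t, time_interval b t -> y (phi t) = x t) ->
    let J := time_interval b in
    (conformable_solution (psi alpha) f x0 J x <->
       classical_solution f x0 (phi @` J) y) /\
    ({for x0, continuous f} ->
       (conformable_solution (psi alpha) f x0 J x /\
          conformable_equation0 (psi alpha) f x) <->
       (classical_solution f x0 (phi @` J) y /\ classical_equation0 f y)).
Proof.
move=> phi.
have w_gt0 (t : R) : 0 < t -> 0 < psi alpha t.
  move=> t0; have [psi_pos _ _] := psi_bij.
  have := psi_pos t; rewrite /= !in_itv/= !andbT; exact.
have w_cont (t : R) : 0 < t -> {for t, continuous (psi alpha)}.
  by move=> t0; apply: psi_cont; rewrite in_itv/= t0.
split; first exact: time_change_inj w_gt0 w_cont phi_fin.
move=> b x y b_gt0 yE J.
have solP := conformable_classical_solution w_gt0 w_cont phi_fin f x0 b_gt0 yE.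
split; first exact: solP.
(* The equation at 0 on each side is derived from the solution on that same side, not transported
   along [phi]. *)
move=> cf; split=> -[sol _].
- split; first exact/solP.
  by have := @classical_solution_equation0 _ _ w_gt0 w_cont phi_fin _ f x0 b y
    b_gt0 cf (solP.1 sol).
- split; first exact/solP.
  exact: conformable_solution_equation0 b_gt0 cf (solP.2 sol).
Qed.
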